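(* Let $\Sigma: A(y) \succeq 0$ be a weakly infeasible semidefinite system in block-diagonal form with blocks $B_1, \dots, B_k$. (a) For any $X \in S(\Sigma)$, there exists an infeasible block subsystem of $\Sigma$ with block index set contained in $\mathrm{BS}(X)$; that is, there exists $I \subseteq \mathrm{BS}(X)$ such that $A(y)_{B(I)} \succeq 0$ is infeasible. (b) For any $X \in S(\Sigma)$ with inclusion-minimal block support (i.e., there is no $X' \in S(\Sigma)$ with $\mathrm{BS}(X') \subsetneq \mathrm{BS}(X)$), the index set $\mathrm{BS}(X)$ defines an IIS of $\Sigma$; that is, the block subsystem of $A(y)$ with respect to $\mathrm{BS}(X)$ is an irreducible infeasible subsystem.
   Context: Let $\mathcal{S}^n$ be the set of real symmetric $n \times n$ matrices, $[n] = \{1,\dots,n\}$, let $\succeq 0$ mean positive semidefinite, and let $A \bullet B = \mathrm{tr}(A^\top B)$. For $A \in \mathcal{S}^n$ and $J \subseteq [n]$, $A_J$ is the submatrix with rows and columns indexed by $J$. Let $\mathbb{I}$ denote the identity matrix of appropriate size. Let $A_0, \dots, A_m \in \mathcal{S}^n$ and, for $y \in \mathbb{R}^m$, let $A(y) = A_0 - \sum_{i=1}^m y_i A_i$. A system $A(y) \succeq 0$ is feasible if some $y \in \mathbb{R}^m$ satisfies it, and infeasible otherwise. It is weakly feasible if for every $\varepsilon > 0$ there is $y \in \mathbb{R}^m$ with $A(y) + \varepsilon \mathbb{I} \succeq 0$; it is weakly infeasible if it is not weakly feasible. The same terminology is used for the systems $A(y)_J \succeq 0$, $J \subseteq [n]$.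 Let $k \geq 1$ and let $B_1, \dots, B_k$ be nonempty sets forming a partition of $[n]$. A matrix $M \in \mathcal{S}^n$ is in block-diagonal form (with respect to these blocks) if $M_{st} = 0$ for all $(s,t) \notin (B_1 \times B_1) \cup \dots \cup (B_k \times B_k)$. The pencil $A(y)$ is in block-diagonal form if all of $A_0, A_1, \dots, A_m$ are. Standing assumption: for each $i \in [k]$, the system $A(y)_{B_i} \succeq 0$ is weakly feasible. For $I \subseteq [k]$ let $B(I) = \bigcup_{i \in I} B_i$; the block subsystem with respect to $I$ is $A(y)_{B(I)} \succeq 0$, and by convention the subsystem for $I = \emptyset$ is feasible. The block subsystem with respect to $I$ is an irreducible infeasible subsystem (IIS) if $A(y)_{B(I)} \succeq 0$ is weakly infeasible but $A(y)_{B(I')} \succeq 0$ is weakly feasible for all $I' \subsetneq I$. The block support of $X \in \mathcal{S}^n$ is $\mathrm{BS}(X) = \{ i \in [k] : X_{B_i} \neq 0\}$. The alternative spectrahedron of $\Sigma: A(y) \succeq 0$ is $$S(\Sigma) = \{ X \succeq 0 : A_i \bullet X = 0 \text{ for } i \in [m],\ A_0 \bullet X = -1 \},$$ where, by standing convention, only matrices $X \in \mathcal{S}^n$ in block-diagonal form with respect to $B_1,\dots,B_k$ are considered. *)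

(* Defs.v *)
From HB Require Import structures.
From mathcomp Require Import all_boot all_order all_algebra.
From mathcomp Require Import reals.

Set Implicit Arguments.
Unset Strict Implicit.
Unset Printing Implicit Defensive.

Import Order.TTheory GRing.Theory Num.Theory.

Local Open Scope ring_scope.

Section SemidefiniteSystems.
Variable R : realType.

Definition psd n (M : 'M[R]_n) : Prop :=
  M \is symmetricmx /\ forall v : 'cV[R]_n, 0 <= (v^T *m M *m v) 0 0.

Definition dotmat n (A B : 'M[R]_n) : R := \tr (A^T *m B).

(* The rows and columns of A_J are listed in increasing order of the indices
   in J; A_J is the 0 x 0 matrix when J is empty. *)
Definition psubmx n (A : 'M[R]_n) (J : {set 'I_n}) : 'M[R]_#|J| :=
  mxsub (@enum_val _ (mem J)) (@enum_val _ (mem J)) A.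

Definition pencil n m (A0 : 'M[R]_n) (A : 'I_m -> 'M[R]_n) (y : 'rV[R]_m) :
    'M[R]_n :=
  A0 - \sum_(i < m) y 0 i *: A i.

(* A system "F(y) >= 0, y in R^m" is given by its matrix-valued function F. *)
Definition feasible n m (F : 'rV[R]_m -> 'M[R]_n) : Prop :=
  exists y, psd (F y).

Definition infeasible n m (F : 'rV[R]_m -> 'M[R]_n) : Prop := ~ feasible F.

Definition weakly_feasible n m (F : 'rV[R]_m -> 'M[R]_n) : Prop :=
  forall e : R, 0 < e -> exists y, psd (F y + e%:M).

Definition weakly_infeasible n m (F : 'rV[R]_m -> 'M[R]_n) : Prop :=
  ~ weakly_feasible F.

(* Injectivity of B makes the k blocks pairwise disjoint as an indexed family,
   since [set B i | i : 'I_k] forgets repetitions. *)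
Definition block_partition n k (B : 'I_k -> {set 'I_n}) : Prop :=
  injective B /\ partition [set B i | i : 'I_k] [set: 'I_n].

Definition block_diag n k (B : 'I_k -> {set 'I_n}) (M : 'M[R]_n) : Prop :=
  forall s t, (forall i, ~~ ((s \in B i) && (t \in B i))) -> M s t = 0.

Definition block_union n k (B : 'I_k -> {set 'I_n}) (I : {set 'I_k}) :
    {set 'I_n} :=
  \bigcup_(i in I) B i.

(* For I = set0 this is a system of 0 x 0 matrices, which is feasible. *)
Definition block_subsystem n m k (B : 'I_k -> {set 'I_n})
    (F : 'rV[R]_m -> 'M[R]_n) (I : {set 'I_k}) (y : 'rV[R]_m) :=
  psubmx (F y) (block_union B I).

Definition is_IIS n m k (B : 'I_k -> {set 'I_n})
    (F : 'rV[R]_m -> 'M[R]_n) (I : {set 'I_k}) : Prop :=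
  weakly_infeasible (block_subsystem B F I) /\
  forall I' : {set 'I_k}, I' \proper I ->
    weakly_feasible (block_subsystem B F I').

Definition block_support n k (B : 'I_k -> {set 'I_n}) (X : 'M[R]_n) :
    {set 'I_k} :=
  [set i | psubmx X (B i) != 0].

Definition alt_spectrahedron n m k (B : 'I_k -> {set 'I_n})
    (A0 : 'M[R]_n) (A : 'I_m -> 'M[R]_n) (X : 'M[R]_n) : Prop :=
  [/\ psd X, block_diag B X, forall i, dotmat (A i) X = 0
    & dotmat A0 X = -1].

End SemidefiniteSystems.

(* Main.v *)
Require Import Defs.
From HB Require Import structures.
From mathcomp Require Import interval_inference boolp classical_sets topology.
From mathcomp Require Import normedtype sequences.
From mathcomp Require Import all_boot all_order all_algebra.
From mathcomp Require Import reals.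
From mathcomp Require Import ring lra.

Set Implicit Arguments.
Unset Strict Implicit.
Unset Printing Implicit Defensive.

Import Order.TTheory GRing.Theory Num.Theory.
Import numFieldNormedType.Exports.

Local Open Scope ring_scope.

(** Write X.Y for dotmat X Y.  Let X lie in the alternative spectrahedron, let
    J be the union of the blocks in its support and let y be arbitrary.  Since X
    vanishes outside J x J, A(y)_J . X_J = A(y).X = -1.  If A(y)_J + e Id were
    positive semidefinite then, the inner product of two positive semidefinite
    matrices being nonnegative (psd_dotmat_ge0), -1 + e tr(X_J) >= 0, which is
    false for small e.  So the block subsystem on the support of X is even
    weakly infeasible (block_support_weakly_infeasible); this gives (a) and the
    first half of (b).

    The second half of (b) is a theorem of the alternative
    (alt_spectrahedron_exists): if the block subsystem on I is weakly
    infeasible, then the alternative spectrahedron contains an X whose block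
    support lies in I.  For I strictly inside a minimal block support no such X
    exists, so the subsystem on I is weakly feasible.

    To find X, let K be the convex cone of symmetric P whose diagonal blocks
    P_(B i), i in I, are positive semidefinite, all other entries being free.
    Weak infeasibility says that the convex set of all A(y) - P, with P in K,
    keeps a positive distance from 0: if A(y) - P had norm at most e, then every
    block A(y)_(B i) + e Id, i in I, would be positive semidefinite, hence so
    would A(y)_(B(I)) + e Id, by psd_blocks.  A functional that separates this
    set from 0 (convex_separation) yields, up to sign and scale, a matrix X with
    X.A_i = 0, X.A_0 = -1 and X.P >= 0 for all P in K.  As K contains v v^T for
    every vector v, X is positive semidefinite; as K contains both signs of each
    symmetrized matrix unit outside the blocks indexed by I, X vanishes there.
    Choosing K this large is what makes X block diagonal with support in I. *)

(** * Trace inner product and positive semidefinite matrices *)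

Section LinearAlgebra.
Variable R : realType.

Lemma symmetricmxP n (M : 'M[R]_n) : reflect (M^T = M) (M \is symmetricmx).
Proof.
rewrite is_hermitianmxE expr0 scale1r.
have -> : (M ^t idfun)%sesqui = M^T by apply/matrixP=> i j; rewrite !mxE.
by apply: (iffP eqP).
Qed.

Lemma dotmatE n (M N : 'M[R]_n) : dotmat M N = \sum_i \sum_j M i j * N i j.
Proof.
rewrite /dotmat /mxtrace exchange_big /=; apply: eq_bigr => j _.
by rewrite mxE; apply: eq_bigr => i _; rewrite mxE.
Qed.

Lemma dotmatC n (M N : 'M[R]_n) : dotmat M N = dotmat N M.
Proof. by rewrite /dotmat -mxtrace_tr trmx_mul trmxK. Qed.

Lemma dotmatDr n (M N P : 'M[R]_n) : dotmat M (N + P) = dotmat M N + dotmat M P.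
Proof. by rewrite /dotmat mulmxDr raddfD. Qed.

Lemma dotmatZr n a (M N : 'M[R]_n) : dotmat M (a *: N) = a * dotmat M N.
Proof. by rewrite /dotmat -scalemxAr linearZ. Qed.

Lemma dotmatDl n (M N P : 'M[R]_n) : dotmat (N + P) M = dotmat N M + dotmat P M.
Proof. by rewrite !(dotmatC _ M) dotmatDr. Qed.

Lemma dotmatZl n a (M N : 'M[R]_n) : dotmat (a *: N) M = a * dotmat N M.
Proof. by rewrite !(dotmatC _ M) dotmatZr. Qed.

Lemma dotmatNr n (M N : 'M[R]_n) : dotmat M (- N) = - dotmat M N.
Proof. by rewrite -scaleN1r dotmatZr mulN1r. Qed.

Lemma dotmatNl n (M N : 'M[R]_n) : dotmat (- N) M = - dotmat N M.
Proof. by rewrite -scaleN1r dotmatZl mulN1r. Qed.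

Lemma dotmat_trl n (M N : 'M[R]_n) : dotmat M^T N = dotmat M N^T.
Proof. by rewrite /dotmat trmxK -[RHS]mxtrace_tr trmx_mul !trmxK mxtrace_mulC. Qed.

Lemma dotmat_scalar n (e : R) (M : 'M[R]_n) : dotmat e%:M M = e * \tr M.
Proof. by rewrite /dotmat tr_scalar_mx mul_scalar_mx linearZ. Qed.

Lemma dotmat_rank1 n (M : 'M[R]_n) (v : 'cV[R]_n) :
  dotmat M (v *m v^T) = (v^T *m M *m v) 0 0.
Proof.
rewrite dotmatC /dotmat trmx_mul trmxK -[v *m _ *m _]mulmxA mxtrace_mulC.
by rewrite trace_mx11.
Qed.

Lemma dotmat_delta n (M : 'M[R]_n) s t : dotmat M (delta_mx s t) = M s t.
Proof.
rewrite dotmatE (bigD1 s) //= (bigD1 t) //= !mxE !eqxx mulr1.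
rewrite big1 => [|j /negPf jt]; last by rewrite mxE jt andbF mulr0.
rewrite big1 ?addr0 // => i /negPf si.
by rewrite big1 // => j _; rewrite mxE si mulr0.
Qed.

Lemma dotmat_ge0 n (M : 'M[R]_n) : 0 <= dotmat M M.
Proof.
by rewrite dotmatE; do 2!apply: sumr_ge0 => ? _; rewrite -expr2 sqr_ge0.
Qed.

Lemma sqr_entry_le_dotmat n (M : 'M[R]_n) s t : (M s t) ^+ 2 <= dotmat M M.
Proof.
rewrite dotmatE (bigD1 s) //= (bigD1 t) //= -expr2 -addrA lerDl.
by rewrite addr_ge0 //; do ?[apply: sumr_ge0 => ? _]; rewrite -expr2 sqr_ge0.
Qed.

(** The discriminant inequality behind both Cauchy-Schwarz inequalities below;
    it includes the degenerate case r = 0. *)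
Lemma discriminant_le (p q r : R) :
  0 <= r -> (forall t, 0 <= p + t * (2 * q) + t ^+ 2 * r) -> q ^+ 2 <= p * r.
Proof.
move=> r0 H; have [r00|rn0] := eqVneq r 0.
  suff -> : q = 0 by rewrite r00 mulr0 expr0n.
  (* at this t the polynomial, affine when r = 0, takes the value -1 *)
  apply/eqP/negPn/negP => q0; have := H (- (p + 1) / (2 * q)).
  by rewrite r00 mulr0 addr0 mulfVK ?mulf_neq0 ?pnatr_eq0 //; lra.
have := H (- q / r); have rp : 0 < r by rewrite lt_def rn0.
have -> : p + - q / r * (2 * q) + (- q / r) ^+ 2 * r = (p * r - q ^+ 2) / r.
  by field.
by rewrite pmulr_lge0 ?invr_gt0 // subr_ge0.
Qed.

Lemma dotmat_cauchy_schwarz n (M N : 'M[R]_n) :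
  dotmat M N ^+ 2 <= dotmat M M * dotmat N N.
Proof.
apply: discriminant_le => [|t]; first exact: dotmat_ge0.
have := dotmat_ge0 (M + t *: N).
rewrite !dotmatDl !dotmatDr !dotmatZl !dotmatZr (dotmatC N M).
by congr (_ <= _); ring.
Qed.

Lemma psd_cauchy_schwarz n (M : 'M[R]_n) (u v : 'cV[R]_n) : psd M ->
  (u^T *m M *m v) 0 0 ^+ 2 <= (u^T *m M *m u) 0 0 * (v^T *m M *m v) 0 0.
Proof.
move=> [/symmetricmxP Ms Mp]; apply: discriminant_le => // t.
have := Mp (u + t *: v).
have vu : (v^T *m M *m u) 0 0 = (u^T *m M *m v) 0 0.
  have <- : (v^T *m M *m u)^T = u^T *m M *m v.
    by rewrite !trmx_mul trmxK Ms mulmxA.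
  by rewrite [RHS]mxE.
have -> : (u + t *: v)^T = u^T + t *: v^T by rewrite linearD linearZ.
rewrite !mulmxDl !mulmxDr -!scalemxAl -!scalemxAr.
move: vu; move: (v^T *m M *m u) (u^T *m M *m v) => a b vu.
move: (u^T *m _ *m _) (v^T *m _ *m _) => c d.
by rewrite !mxE vu; congr (_ <= _); ring.
Qed.

Lemma psd_rank1 n (v : 'cV[R]_n) : psd (v *m v^T).
Proof.
split; first by apply/symmetricmxP; rewrite trmx_mul trmxK.
move=> w; have -> : w^T *m (v *m v^T) *m w = (v^T *m w)^T *m (v^T *m w).
  by rewrite trmx_mul trmxK !mulmxA.
by rewrite mxE big_ord1 mxE -expr2 sqr_ge0.
Qed.

Lemma psd_congr n p (S : 'M[R]_(n, p)) (M : 'M[R]_n) :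
  psd M -> psd (S^T *m M *m S).
Proof.
move=> [/symmetricmxP Ms Mp]; split.
  by apply/symmetricmxP; rewrite !trmx_mul trmxK Ms mulmxA.
by move=> v; have := Mp (S *m v); rewrite trmx_mul !mulmxA.
Qed.

Lemma psdD n (M N : 'M[R]_n) : psd M -> psd N -> psd (M + N).
Proof.
move=> [/symmetricmxP Ms Mp] [/symmetricmxP Ns Np]; split.
  by apply/symmetricmxP; rewrite linearD /= Ms Ns.
by move=> v; rewrite mulmxDr mulmxDl mxE addr_ge0.
Qed.

Lemma psdZ n a (M : 'M[R]_n) : 0 <= a -> psd M -> psd (a *: M).
Proof.
move=> a0 [/symmetricmxP Ms Mp]; split.
  by apply/symmetricmxP; rewrite linearZ /= Ms.
by move=> v; rewrite -scalemxAr -scalemxAl mxE mulr_ge0.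
Qed.

Lemma psd_scalar n (e : R) : 0 <= e -> psd (e%:M : 'M[R]_n).
Proof.
move=> e0; split; first by apply/symmetricmxP; rewrite tr_scalar_mx.
move=> v; rewrite mul_mx_scalar -scalemxAl mxE mulr_ge0 // mxE.
by apply: sumr_ge0 => i _; rewrite mxE -expr2 sqr_ge0.
Qed.

Lemma psd0 n : psd (0 : 'M[R]_n).
Proof. by rewrite -(scale0r 1%:M); apply: psdZ => //; exact: psd_scalar. Qed.

Lemma quadform_delta n (M : 'M[R]_n) s t :
  ((delta_mx s 0 : 'cV[R]_n)^T *m M *m (delta_mx t 0 : 'cV[R]_n)) 0 0 = M s t.
Proof. by rewrite trmx_delta -rowE -colE !mxE. Qed.

Lemma psd_diag_ge0 n (M : 'M[R]_n) s : psd M -> 0 <= M s s.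
Proof. by move=> [_ /(_ (delta_mx s 0))]; rewrite quadform_delta. Qed.

Lemma psd_mxtrace_ge0 n (M : 'M[R]_n) : psd M -> 0 <= \tr M.
Proof. by move=> Mp; apply: sumr_ge0 => i _; apply: psd_diag_ge0. Qed.

(** Self-duality of the positive semidefinite cone (the easy inclusion).  Instead
    of a spectral decomposition of N, rank-one terms are peeled off as in the
    Cholesky factorization: for a pivot N s s > 0, N is the sum of w w^T / N s s,
    with w the column s of N, and of a positive semidefinite matrix with fewer
    nonzero diagonal entries. *)
Lemma psd_dotmat_ge0 n (M N : 'M[R]_n) : psd M -> psd N -> 0 <= dotmat M N.
Proof.
move=> Mp; have [c] := ubnP #|[pred s | N s s != 0]|.
elim: c N => // c IH N cN Np.
case: (pickP [pred s | N s s != 0]) => [s /= Ns0|N0]; last first.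
  (* a positive semidefinite matrix with zero diagonal is zero *)
  suff -> : N = 0 by rewrite /dotmat mulmx0 mxtrace0.
  apply/matrixP => s t; rewrite mxE; apply/eqP; rewrite -sqrf_eq0 eq_le sqr_ge0.
  have := psd_cauchy_schwarz (delta_mx s 0) (delta_mx t 0) Np.
  by rewrite !quadform_delta andbT; move/negbFE/eqP: (N0 s) => ->; rewrite mul0r.
have Nsp : 0 < N s s by rewrite lt_def Ns0 psd_diag_ge0.
set w := col s N; pose N' := N - (N s s)^-1 *: (w *m w^T).
have -> : N = N' + (N s s)^-1 *: (w *m w^T) by rewrite subrK.
have N's : psd N'.
  split.
    apply/symmetricmxP; rewrite linearB linearZ /= trmx_mul trmxK.
    by have [/symmetricmxP -> _] := Np.
  move=> v; rewrite mulmxBr mulmxBl -scalemxAr -scalemxAl mulmxA.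
  have := psd_cauchy_schwarz v (delta_mx s 0) Np.
  rewrite quadform_delta -mulmxA -colE -/w.
  have -> : v^T *m w *m w^T *m v = (v^T *m w) *m (v^T *m w)^T.
    by rewrite trmx_mul trmxK !mulmxA.
  move: (v^T *m w) (v^T *m N *m v) => a b H.
  rewrite !mxE big_ord1 !mxE -expr2 subr_ge0 mulrC ler_pdivrMr //.
rewrite dotmatDr dotmatZr dotmat_rank1 addr_ge0 //; last first.
  by rewrite mulr_ge0 ?invr_ge0 ?(ltW Nsp) //; have [_ ->] := Mp.
have N'E t : N' t t = N t t - (N s s)^-1 * (N t s) ^+ 2.
  by rewrite !mxE big_ord1 !mxE expr2.
apply: IH (N's); rewrite -ltnS; apply: leq_trans cN; rewrite ltnS.
apply: proper_card; apply/properP; split.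
  apply/subsetP => t; rewrite !inE; apply: contra => /eqP Nt.
  rewrite eq_le; apply/andP; split; last exact: psd_diag_ge0.
  by rewrite N'E Nt sub0r oppr_le0 mulr_ge0 ?sqr_ge0 ?invr_ge0 ?(ltW Nsp).
by exists s; rewrite !inE // N'E expr2 mulKf // subrr eqxx.
Qed.

End LinearAlgebra.

(** * Separation of a convex set from the origin *)

Section Separation.
Variable R : realType.
Local Open Scope classical_set_scope.

Lemma cvg_dotmat n (U V : nat -> 'M[R]_n) (X Y : 'M[R]_n) :
  (forall s t, U j s t @[j --> \oo] --> X s t) ->
  (forall s t, V j s t @[j --> \oo] --> Y s t) ->
  dotmat (U j) (V j) @[j --> \oo] --> dotmat X Y.
Proof.
move=> UX VY; under eq_fun do rewrite dotmatE.
rewrite dotmatE; apply: cvg_big => [|s _]; first exact: add_continuous.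
apply: cvg_big => [|t _]; first exact: add_continuous.
exact: cvgM (UX s t) (VY s t).
Qed.

(** Completeness of the matrix space for the Frobenius norm; the Cauchy
    condition compares all late terms with one fixed term Z N. *)
Lemma dotmat_cauchy_cvg n (Z : nat -> 'M[R]_n) :
  (forall e : R, 0 < e -> exists N, forall j, (N <= j)%N ->
     dotmat (Z N - Z j) (Z N - Z j) < e) ->
  exists X : 'M[R]_n, forall s t, Z j s t @[j --> \oo] --> X s t.
Proof.
move=> Zc; exists (\matrix_(s, t) lim (Z j s t @[j --> \oo])) => s t.
rewrite mxE; apply/cauchy_cvgP/cauchy_exP => e e0.
have [N HN] := Zc (e ^+ 2) (exprn_gt0 2 e0).
exists (Z N s t); exists N => // j /= Nj.
rewrite /ball /= -(@ltr_pXn2r _ 2) ?nnegrE ?(ltW e0) // real_normK ?num_real //.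
apply: le_lt_trans (HN j Nj).
by have := sqr_entry_le_dotmat (Z N - Z j) s t; rewrite !mxE.
Qed.

(** The separating functional is the point X of least norm in the closure of C,
    the limit of a minimizing sequence: such a sequence is Cauchy by the
    parallelogram law, and minimality along the segment from X to W gives
    X.W >= X.X. *)
Lemma convex_separation n (C : 'M[R]_n -> Prop) (d : R) :
  (exists W, C W) ->
  (forall U V (t : R), C U -> C V -> 0 <= t <= 1 -> C (U + t *: (V - U))) ->
  (forall W, C W -> d <= dotmat W W) ->
  exists X : 'M[R]_n, forall W, C W -> d <= dotmat X W.
Proof.
move=> [W0 CW0] Cconv Cd.
pose E : set R := [set r | exists2 W, C W & r = dotmat W W].
have Einf : has_inf E.
  by split; [exists (dotmat W0 W0), W0|exists d => _ [W CW ->]; exact: Cd].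
have [d0 d0E] : exists d0, d0 = inf E by exists (inf E).
have d0_le W : C W -> d0 <= dotmat W W.
  by move=> CW; rewrite d0E; apply: ge_inf; [case: Einf|exists W].
have d_le : d <= d0.
  by rewrite d0E; apply: lb_le_inf => [|_ [W CW ->]]; [case: Einf|exact: Cd].
have exZ (j : nat) : exists W, C W /\ dotmat W W < d0 + j.+1%:R^-1.
  have /(@inf_adherent R E) /(_ Einf) : 0 < j.+1%:R^-1 :> R by rewrite invr_gt0.
  by rewrite -d0E; case=> _ [W CW ->] ?; exists W.
have [Z HZ] := choice exZ.
have [X ZX] : exists X : 'M[R]_n, forall s t, Z j s t @[j --> \oo] --> X s t.
  apply: dotmat_cauchy_cvg => e e0.
  have [N _ HN] := near_infty_natSinv_lt (PosNum (divr_gt0 e0 (ltr0n R 4))).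
  exists N => j Nj.
  have eN : N.+1%:R^-1 < e / 4 := HN N (leqnn N).
  have ej : j.+1%:R^-1 < e / 4 := HN j Nj.
  have [CN ZN] := HZ N; have [Cj Zj] := HZ j.
  (* the midpoint lies in C, so its squared norm is at least d0 *)
  have mid : C (Z N + 2^-1 *: (Z j - Z N)) by apply: Cconv => //; lra.
  have := d0_le _ mid; rewrite !(dotmatDl, dotmatDr, dotmatZl, dotmatZr, dotmatNl, dotmatNr).
  move: ZN Zj; rewrite (dotmatC (Z j) (Z N)).
  by move: eN ej; move: (N.+1%:R^-1) (j.+1%:R^-1) => x y; lra.
have XX : dotmat X X <= d0.
  have H : (d0 + j.+1%:R^-1) @[j --> \oo] --> d0 + 0.
    by apply: cvgD; [exact: cvg_cst|exact: cvg_harmonic].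
  rewrite -[d0]addr0; apply: ler_cvg_to (cvg_dotmat ZX ZX) H _.
  by near=> j; apply: ltW; case: (HZ j).
exists X => W CW.
have key (t : R) : 0 <= t <= 1 -> d0 <= dotmat (X + t *: (W - X)) (X + t *: (W - X)).
  move=> t01; pose V j := Z j + t *: (W - Z j).
  have VX : forall s u, V j s u @[j --> \oo] --> (X + t *: (W - X)) s u.
    move=> s u; rewrite !mxE; under eq_fun do rewrite !mxE.
    apply: cvgD; first exact: ZX.
    by apply: cvgM; [exact: cvg_cst|apply: cvgB; [exact: cvg_cst|exact: ZX]].
  apply: cvgr_to_ge (cvg_dotmat VX VX) _.
  by near=> j; apply/d0_le/Cconv => //; case: (HZ j).
have := key 0; rewrite scale0r addr0 lexx ler01 => /(_ isT) dX.
suff : dotmat X X <= dotmat X W by lra.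
rewrite leNgt; apply/negP => XW.
have b0 := dotmat_ge0 (W - X).
pose a := dotmat X X - dotmat X W.
pose b := dotmat (W - X) (W - X).
have a0 : 0 < a by rewrite subr_gt0.
have ab : 0 < a + b by rewrite ltr_wpDr.
(* The squared norm at X + t (W - X) is X.X + t (t b - 2 a), which is smaller
   than X.X for this t because t b <= a. *)
pose t := a / (a + b).
have t0 : 0 < t by rewrite divr_gt0.
have t1 : t <= 1 by rewrite ler_pdivrMr // mul1r lerDl.
have := key t; rewrite (ltW t0) t1 => /(_ isT).
have -> : dotmat (X + t *: (W - X)) (X + t *: (W - X)) = dotmat X X + t * (t * b - 2 * a).
  rewrite /a /b !(dotmatDl, dotmatDr, dotmatZl, dotmatZr, dotmatNl, dotmatNr).
  by rewrite (dotmatC W X); ring.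
have : t * b <= a.
  by rewrite /t mulrAC ler_pdivrMr // ler_pM2l // lerDr (ltW a0).
by nra.
Unshelve. all: by end_near.
Qed.

End Separation.

(** * Principal submatrices and blocks *)

Section Blocks.
Variables (R : realType) (n : nat).
Implicit Types (M X : 'M[R]_n) (J : {set 'I_n}).

Lemma psubmxD M X J : psubmx (M + X) J = psubmx M J + psubmx X J.
Proof. by apply/matrixP => i j; rewrite !mxE. Qed.

Lemma psubmxZ a M J : psubmx (a *: M) J = a *: psubmx M J.
Proof. by apply/matrixP => i j; rewrite !mxE. Qed.

Lemma psubmx_scalar (e : R) J : psubmx (e%:M : 'M[R]_n) J = e%:M.
Proof. by apply/matrixP => i j; rewrite !mxE (inj_eq enum_val_inj). Qed.

Lemma psubmx_eq0P M J :
  psubmx M J = 0 <-> (forall s t, s \in J -> t \in J -> M s t = 0).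
Proof.
split=> [M0 s t sJ tJ|M0]; last first.
  by apply/matrixP => i j; rewrite !mxE M0 // enum_valP.
have := congr1 (fun N : 'M_#|J| => N (enum_rank_in sJ s) (enum_rank_in tJ t)) M0.
by rewrite !mxE !enum_rankK_in.
Qed.

Lemma psd_psubmx M J : psd M -> psd (psubmx M J).
Proof.
have -> : psubmx M J =
    (colsub (@enum_val _ (mem J)) 1%:M)^T *m M *m colsub (@enum_val _ (mem J)) 1%:M.
  by rewrite /psubmx -[M in LHS]mulmx1 mxsub_mul rowsubE trmx_mxsub trmx1.
exact: psd_congr.
Qed.

Lemma dotmat_psubmx M X J :
  dotmat (psubmx M J) (psubmx X J) = \sum_(s in J) \sum_(t in J) M s t * X s t.
Proof.
rewrite dotmatE [RHS]big_enum_val; apply: eq_bigr => i _.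
by rewrite [RHS]big_enum_val; apply: eq_bigr => j _; rewrite !mxE.
Qed.

(** If X vanishes outside J x J, the inner product only sees the submatrices. *)
Lemma dotmat_psubmx_supp M X J :
  (forall s t, X s t != 0 -> (s \in J) && (t \in J)) ->
  dotmat (psubmx M J) (psubmx X J) = dotmat M X.
Proof.
move=> XJ; rewrite dotmat_psubmx dotmatE [RHS](bigID (mem J)) /=.
rewrite [X in _ + X]big1 ?addr0 => [|s sJ]; last first.
  rewrite big1 // => t _; have [->|/XJ] := eqVneq (X s t) 0; first by rewrite mulr0.
  by rewrite (negPf sJ).
apply: eq_bigr => s sJ; rewrite [RHS](bigID (mem J)) /=.
rewrite [X in _ + X]big1 ?addr0 // => t tJ.
have [->|/XJ] := eqVneq (X s t) 0; first by rewrite mulr0.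
by rewrite (negPf tJ) andbF.
Qed.

Variables (k : nat) (B : 'I_k -> {set 'I_n}).
Hypothesis B_part : block_partition B.

Lemma block_inj i j s : s \in B i -> s \in B j -> i = j.
Proof.
case: B_part => Binj /and3P[_ /trivIsetP tB _] si sj.
have [/Binj //|ij] := eqVneq (B i) (B j).
have := tB _ _ (imset_f B (isT : i \in (predT : pred _))) (imset_f B (isT : j \in (predT : pred _))) ij.
by move/pred0P/(_ s); rewrite /= si sj.
Qed.

Lemma block_diag_scalar (e : R) : block_diag B (e%:M : 'M[R]_n).
Proof.
move=> s t st; rewrite mxE; case: eqVneq st => [<- st|//].
case: B_part => _ /cover_partition cB.
have : s \in cover [set B i | i : 'I_k] by rewrite cB in_setT.
by case/bigcupP => _ /imsetP[i _ ->] si; have := st i; rewrite si.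
Qed.

(** Only one of the two matrices has to be block diagonal. *)
Lemma dotmat_blocks M X (I : {set 'I_k}) : block_diag B M ->
  dotmat (psubmx M (block_union B I)) (psubmx X (block_union B I)) =
  \sum_(i in I) dotmat (psubmx M (B i)) (psubmx X (B i)).
Proof.
move=> Md; rewrite dotmat_psubmx.
have -> : \sum_(i in I) dotmat (psubmx M (B i)) (psubmx X (B i)) =
    \sum_(i in I) \sum_(s in B i) \sum_(t in block_union B I) M s t * X s t.
  apply: eq_bigr => i iI; rewrite dotmat_psubmx; apply: eq_bigr => s si.
  (* M s t = 0 for s in B i and t outside B i *)
  rewrite [RHS](bigID (mem (B i))) /= [X in _ + X]big1 ?addr0 => [|t /andP[_ ti]].
    apply: eq_bigl => t; case ti: (t \in B i); rewrite ?andbF // andbT.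
    by apply/esym/bigcupP; exists i.
  rewrite Md ?mul0r // => j; apply/negP => /andP[/(block_inj si) <-].
  by rewrite (negPf ti).
pose F i := if i \in I then B i else set0.
have {1}-> : block_union B I = \bigcup_i F i by rewrite /block_union big_mkcond.
rewrite partition_disjoint_bigcup => [|i j ij].
  rewrite [RHS]big_mkcond; apply: eq_bigr => i _; rewrite /F.
  by case: ifP => // _; rewrite big_set0.
rewrite -setI_eq0; apply/eqP/setP => s; rewrite inE in_set0.
apply/negP => /andP[]; rewrite /F; do 2!case: ifP; rewrite ?inE // => _ _ si sj.
by rewrite (block_inj si sj) eqxx in ij.
Qed.

(** A block-diagonal symmetric matrix is positive semidefinite as soon as its
    diagonal blocks are: its quadratic form is an inner product with v v^T,
    which splits over the blocks. *)
Lemma psd_blocks M (I : {set 'I_k}) : M \is symmetricmx -> block_diag B M ->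
  (forall i, i \in I -> psd (psubmx M (B i))) -> psd (psubmx M (block_union B I)).
Proof.
move=> /symmetricmxP Ms Md Mp; split.
  apply/symmetricmxP/matrixP => i j; rewrite !mxE.
  by rewrite -[in LHS]Ms mxE.
move=> v; set J := block_union B I in v *.
(* w extends v by zero outside J *)
pose w : 'cV[R]_n := \col_s \sum_(j | enum_val j == s) v j 0.
rewrite -dotmat_rank1.
have -> : v *m v^T = psubmx (w *m w^T) J.
  have wE j : w (enum_val j) 0 = v j 0.
    rewrite mxE (bigD1 j) //= big1 ?addr0 // => i /andP[/eqP /enum_val_inj ->].
    by rewrite eqxx.
  by apply/matrixP => i j; rewrite !mxE !big_ord1 [w^T _ _]mxE [v^T _ _]mxE !wE.
rewrite dotmat_blocks //; apply: sumr_ge0 => i /Mp iI.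
by apply: psd_dotmat_ge0 => //; apply/psd_psubmx/psd_rank1.
Qed.

Lemma block_support_entry X s t :
  block_diag B X -> X s t != 0 ->
  (s \in block_union B (block_support B X)) &&
  (t \in block_union B (block_support B X)).
Proof.
move=> Xd Xst.
have [i /andP[si ti]] : exists i, (s \in B i) && (t \in B i).
  by apply/existsP; apply: contraNT Xst => /existsPn H; apply/eqP/Xd.
have iX : i \in block_support B X.
  rewrite inE; apply: contraNneq Xst => /psubmx_eq0P X0.
  by apply/eqP/X0.
by apply/andP; split; apply/bigcupP; exists i.
Qed.

End Blocks.

(** * The alternative spectrahedron and weak infeasibility *)

Section Alternative.
Variables (R : realType) (n m k : nat).
Variables (A0 : 'M[R]_n) (A : 'I_m -> 'M[R]_n) (B : 'I_k -> {set 'I_n}).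

Lemma dotmat_pencil (X : 'M[R]_n) y :
  dotmat (pencil A0 A y) X = dotmat A0 X - \sum_i y 0 i * dotmat (A i) X.
Proof.
rewrite /pencil dotmatDl dotmatNl; congr (_ - _).
rewrite (big_morph (fun Y => dotmat Y X) (fun M N => dotmatDl X M N)
  (_ : dotmat 0 X = 0)); last by rewrite -(scale0r X) dotmatZl mul0r.
by apply: eq_bigr => i _; rewrite dotmatZl.
Qed.

Lemma pencil_affine y z (t : R) :
  pencil A0 A (y + t *: (z - y)) =
  pencil A0 A y + t *: (pencil A0 A z - pencil A0 A y).
Proof.
rewrite /pencil.
have -> : \sum_(i < m) (y + t *: (z - y)) 0 i *: A i =
    \sum_i y 0 i *: A i + t *: (\sum_i z 0 i *: A i - \sum_i y 0 i *: A i).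
  rewrite -sumrB scaler_sumr -big_split /=; apply: eq_bigr => i _.
  by rewrite !mxE -scalerBl scalerA -scalerDl.
move: (\sum_i y 0 i *: A i) (\sum_i z 0 i *: A i) => Y Z.
by apply/matrixP => i j; rewrite !mxE; ring.
Qed.

Lemma pencil_symmetric y : A0 \is symmetricmx ->
  (forall i, A i \is symmetricmx) -> pencil A0 A y \is symmetricmx.
Proof.
move=> /symmetricmxP A0s As; apply/symmetricmxP.
rewrite /pencil linearB /= A0s linear_sum; congr (_ - _).
by apply: eq_bigr => i _; rewrite linearZ /= (symmetricmxP _ (As i)).
Qed.

Lemma pencil_block_diag y : block_diag B A0 ->
  (forall i, block_diag B (A i)) -> block_diag B (pencil A0 A y).
Proof.
move=> A0d Ad s t st; rewrite /pencil !mxE A0d // summxE big1 ?subr0 // => i _.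
by rewrite mxE Ad // mulr0.
Qed.

Lemma weakly_infeasible_infeasible p (F : 'rV[R]_m -> 'M[R]_p) :
  weakly_infeasible F -> infeasible F.
Proof.
move=> Fw [y Fy]; apply: Fw => e e0; exists y.
by apply: psdD => //; apply/psd_scalar/ltW.
Qed.

(** The support of any point of the alternative spectrahedron indexes a weakly
    infeasible block subsystem. *)
Lemma block_support_weakly_infeasible X : alt_spectrahedron B A0 A X ->
  weakly_infeasible (block_subsystem B (pencil A0 A) (block_support B X)).
Proof.
move=> [Xp Xd AX A0X]; set J := block_union B (block_support B X).
have XJp : psd (psubmx X J) by exact: psd_psubmx.
have tr0 := psd_mxtrace_ge0 XJp; set tr := \tr (psubmx X J) in tr0.
have tr1 : 0 < tr + 1 by rewrite ltr_wpDl.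
(* with this e, -1 + e tr(X_J) is negative *)
move=> /(_ (tr + 1)^-1); rewrite invr_gt0 tr1 => /(_ isT)[y yp].
have := psd_dotmat_ge0 yp XJp.
rewrite dotmatDl dotmat_scalar dotmat_psubmx_supp; last first.
  by move=> s t; exact: block_support_entry.
rewrite dotmat_pencil A0X big1 => [|i _]; last by rewrite AX mulr0.
rewrite subr0 -/tr addrC subr_ge0 mulrC ler_pdivlMr // mul1r.
by rewrite leNgt ltrDl ltr01.
Qed.

(** A symmetric matrix is bounded below by minus its Frobenius norm, by
    Cauchy-Schwarz against v v^T. *)
Lemma psd_perturbation (Z : 'M[R]_n) (e : R) : 0 <= e ->
  Z \is symmetricmx -> dotmat Z Z <= e ^+ 2 -> psd (Z + e%:M).
Proof.
move=> e0 /symmetricmxP Zs Ze; split.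
  by apply/symmetricmxP; rewrite linearD /= tr_scalar_mx Zs.
move=> v; rewrite -dotmat_rank1 dotmatDl dotmat_scalar.
set q := \tr _.
have q0 : 0 <= q by exact/psd_mxtrace_ge0/psd_rank1.
have qE : dotmat (v *m v^T) (v *m v^T) = q ^+ 2.
  rewrite dotmat_rank1 /q mxtrace_mulC trace_mx11 !mulmxA -mulmxA.
  by rewrite mxE big_ord1 expr2.
have := dotmat_cauchy_schwarz Z (v *m v^T); rewrite qE => H.
have : `|dotmat Z (v *m v^T)| <= e * q.
  rewrite -(@ler_pXn2r _ 2) ?nnegrE ?mulr_ge0 // real_normK ?num_real //.
  by apply: le_trans H _; rewrite exprMn ler_wpM2r ?sqr_ge0.
by rewrite ler_norml => /andP[H' _]; rewrite -lerBlDr sub0r.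
Qed.

Hypothesis B_part : block_partition B.
Hypotheses (A0_sym : A0 \is symmetricmx) (A_sym : forall i, A i \is symmetricmx).
Hypotheses (A0_diag : block_diag B A0) (A_diag : forall i, block_diag B (A i)).

(** The theorem of the alternative, with control of the block support. *)
Lemma alt_spectrahedron_exists (I : {set 'I_k}) :
  weakly_infeasible (block_subsystem B (pencil A0 A) I) ->
  exists2 X, alt_spectrahedron B A0 A X & block_support B X \subset I.
Proof.
move=> Iwinf.
have [e e0 He] : exists2 e : R, 0 < e &
    forall y, ~ psd (block_subsystem B (pencil A0 A) I y + e%:M).
  apply: contrapT => H; apply: Iwinf => e e0; apply: contrapT => H'.
  by apply: H; exists e => // y yp; apply: H'; exists y.
pose K (P : 'M[R]_n) :=
  P \is symmetricmx /\ forall i, i \in I -> psd (psubmx P (B i)).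
have Kpsd P : psd P -> K P.
  by move=> Pp; split; [case: Pp|move=> i _; exact: psd_psubmx].
have KD P Q : K P -> K Q -> K (P + Q).
  move=> [/symmetricmxP Ps Pp] [/symmetricmxP Qs Qp]; split.
    by apply/symmetricmxP; rewrite linearD /= Ps Qs.
  by move=> i iI; rewrite psubmxD; apply: psdD; [exact: Pp|exact: Qp].
have KZ (a : R) P : 0 <= a -> K P -> K (a *: P).
  move=> a0 [/symmetricmxP Ps Pp]; split.
    by apply/symmetricmxP; rewrite linearZ /= Ps.
  by move=> i iI; rewrite psubmxZ; apply: psdZ => //; exact: Pp.
pose C (Z : 'M[R]_n) := exists y P, K P /\ Z = pencil A0 A y - P.
have Csym Z : C Z -> Z^T = Z.
  move=> [y [P [[/symmetricmxP Ps _] ->]]]; rewrite linearB /= Ps.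
  by rewrite (symmetricmxP _ (pencil_symmetric y A0_sym A_sym)).
have [X HX] : exists X, forall Z, C Z -> e ^+ 2 <= dotmat X Z.
  apply: convex_separation.
  - by exists (pencil A0 A 0 - 0), 0, 0; split=> //; apply/Kpsd/psd0.
  - move=> _ _ t [y [P [KP ->]]] [z [Q [KQ ->]]] /andP[t0 t1].
    exists (y + t *: (z - y)), ((1 - t) *: P + t *: Q); split.
      by apply: KD; apply: KZ; rewrite ?subr_ge0.
    rewrite pencil_affine; move: (pencil A0 A y) (pencil A0 A z) => Y Z.
    by apply/matrixP => i j; rewrite !mxE; ring.
  move=> Z CZ; rewrite leNgt; apply/negP => /ltW Ze; have Zs := Csym _ CZ.
  case: CZ Ze Zs => y [P [[_ Pp] ->]] Ze Zs; apply: (He y).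
  rewrite /block_subsystem -psubmx_scalar -psubmxD.
  have eZ := psd_perturbation (ltW e0) (introT (symmetricmxP _) Zs) Ze.
  apply: psd_blocks => //.
  + apply/symmetricmxP; rewrite linearD /= tr_scalar_mx.
    by rewrite (symmetricmxP _ (pencil_symmetric y A0_sym A_sym)).
  + move=> s t st; rewrite mxE (pencil_block_diag _ A0_diag A_diag) // add0r.
    exact: (block_diag_scalar B_part).
  move=> i iI.
  rewrite -[pencil A0 A y](subrK P) addrAC psubmxD.
  by apply: psdD; [exact: psd_psubmx|exact: Pp].
have e2 : 0 < e ^+ 2 by rewrite exprn_gt0.
(* X need not be symmetric; symmetrizing only doubles its products with the
   symmetric elements of C *)
pose X1 := - (X + X^T).
have X1s : X1^T = X1 by rewrite /X1 linearN linearD /= trmxK addrC.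
have HX1 y P : K P -> dotmat (pencil A0 A y) X1 - dotmat P X1 < 0.
  move=> KP; rewrite -dotmatNl -dotmatDl.
  have CZ : C (pencil A0 A y - P) by exists y, P.
  rewrite dotmatC dotmatNl dotmatDl dotmat_trl (Csym _ CZ) oppr_lt0.
  by have := HX _ CZ; lra.
have K0 : K 0 by apply/Kpsd/psd0.
have dot0 : dotmat 0 X1 = 0 by rewrite -(scale0r X1) dotmatZl mul0r.
have X1K P : K P -> 0 <= dotmat P X1.
  move=> KP; rewrite leNgt; apply/negP => p0.
  (* a multiple of P large enough to offset A(0).X1 *)
  have := HX1 0 _ (KZ (`|dotmat (pencil A0 A 0) X1| / - dotmat P X1) _ _ KP).
  rewrite divr_ge0 ?oppr_ge0 ?(ltW p0) // => /(_ isT).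
  rewrite dotmatZl invrN mulrN mulNr opprK divfK ?lt_eqF //.
  by have := ler_norm (- dotmat (pencil A0 A 0) X1); rewrite normrN; lra.
have A0X1 : dotmat A0 X1 < 0.
  have := HX1 0 0 K0; rewrite dot0 subr0 dotmat_pencil big1 ?subr0 // => i _.
  by rewrite mxE mul0r.
have AX1 i : dotmat (A i) X1 = 0.
  apply/eqP/negPn/negP => q0.
  (* this y makes A(y).X1 vanish *)
  have := HX1 ((dotmat A0 X1 / dotmat (A i) X1) *: delta_mx 0 i) 0 K0.
  rewrite dot0 subr0 dotmat_pencil (bigD1 i) //= big1 => [|j ji].
    by rewrite !mxE !eqxx mulr1 divfK // addr0 subrr ltxx.
  by rewrite !mxE (negPf ji) andbF mulr0 mul0r.
have X1supp s t : (forall i, i \in I -> ~~ ((s \in B i) && (t \in B i))) ->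
    X1 s t = 0.
  move=> st; pose P : 'M[R]_n := delta_mx s t + delta_mx t s.
  have P0 i : i \in I -> psubmx P (B i) = 0.
    move=> iI; apply/psubmx_eq0P => u v ui vi; rewrite !mxE.
    have := st i iI; rewrite negb_and => H.
    have -> : (u == s) && (v == t) = false.
      by apply/negP => /andP[/eqP us /eqP vt]; move: H; rewrite -us -vt ui vi.
    have -> : (u == t) && (v == s) = false.
      by apply/negP => /andP[/eqP us /eqP vt]; move: H; rewrite -us -vt ui vi.
    by rewrite addr0.
  have Ps : P^T = P by rewrite /P linearD /= !trmx_delta addrC.
  have KP (a : R) : K (a *: P).
    split; first by apply/symmetricmxP; rewrite linearZ /= Ps.
    by move=> i iI; rewrite psubmxZ P0 // scaler0; exact: psd0.
  have := X1K _ (KP 1); have := X1K _ (KP (-1)).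
  rewrite !dotmatZl dotmatC dotmatDr !dotmat_delta.
  have -> : X1 t s = X1 s t by rewrite -[in LHS]X1s mxE.
  by lra.
exists ((- dotmat A0 X1)^-1 *: X1).
  split.
  - apply: psdZ; first by rewrite invr_ge0 oppr_ge0 ltW.
    split; first exact/symmetricmxP.
    by move=> v; rewrite -dotmat_rank1 dotmatC; apply/X1K/Kpsd/psd_rank1.
  - by move=> s t st; rewrite mxE X1supp ?mulr0.
  - by move=> i; rewrite dotmatZr AX1 mulr0.
  - by rewrite dotmatZr invrN mulNr mulVf // lt_eqF.
apply/subsetP => i; rewrite inE; apply: contraR => iI.
apply/eqP/psubmx_eq0P => s t si ti; rewrite mxE X1supp ?mulr0 // => j jI.
by apply: contra iI => /andP[sj _]; rewrite (block_inj B_part si sj).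
Qed.

End Alternative.

Theorem lemma3p3 (R : realType) (n m k : nat)
    (A0 : 'M[R]_n) (A : 'I_m -> 'M[R]_n) (B : 'I_k -> {set 'I_n})
    (k_gt0 : (0 < k)%N)
    (A0_sym : A0 \is symmetricmx) (A_sym : forall i, A i \is symmetricmx)
    (B_part : block_partition B)
    (A0_diag : block_diag B A0) (A_diag : forall i, block_diag B (A i))
    (blocks_wf : forall i, weakly_feasible (fun y => psubmx (pencil A0 A y) (B i)))
    (Sigma_winf : weakly_infeasible (pencil A0 A)) :
  (forall X : 'M[R]_n, alt_spectrahedron B A0 A X ->
     exists I : {set 'I_k}, I \subset block_support B X /\
       infeasible (block_subsystem B (pencil A0 A) I))
  /\
  (forall X : 'M[R]_n, alt_spectrahedron B A0 A X ->
     (~ exists X' : 'M[R]_n, alt_spectrahedron B A0 A X' /\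
          block_support B X' \proper block_support B X) ->
     is_IIS B (pencil A0 A) (block_support B X)).
Proof.
split=> [X SX|X SX Xmin].
  exists (block_support B X); split=> //.
  exact/weakly_infeasible_infeasible/block_support_weakly_infeasible.
split; first exact: block_support_weakly_infeasible.
move=> I' I'X; apply: contrapT => /alt_spectrahedron_exists.
case=> // X' SX' X'I'; apply: Xmin; exists X'; split=> //.
exact: sub_proper_trans X'I' I'X.
Qed.
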